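(* Let $1\le p<\infty$ and let $\mu$ be a nonzero Radon measure on $\mathbb{R}$. Then $\mu$ satisfies both (i) whenever $f,g$ are extended real-valued Borel functions on $\mathbb{R}$ with $f=g$ $\mu$-a.e., then $T_t(f)=T_t(g)$ $\mu$-a.e. for all $t\in\mathbb{R}$; and (ii) whenever $f$ is a Borel function on $\mathbb{R}$ with $\int_{\mathbb{R}}|f(x)|^p\,d\mu(x)<\infty$, then $\int_{\mathbb{R}}|T_t(f)(x)|^p\,d\mu(x)<\infty$ for all $t\in\mathbb{R}$, if and only if $\mu$ is equivalent to Lebesgue measure $m$ and the Radon–Nikodym derivative $h:=\frac{d\mu}{dm}$ satisfies: for each real number $L>0$ there is a constant $C_L$ such that if $I$ is any interval of length $L$, then $$\|h\|_{I,\infty}\,\|1/h\|_{I,\infty}\le C_L .$$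
   Context: A Radon measure on $\mathbb{R}$ is a positive Borel measure $\mu$ on $\mathbb{R}$ with $\mu([-n,n])<\infty$ for all $n\in\mathbb{N}$. For an extended real-valued function $f$ on $\mathbb{R}$ and $t\in\mathbb{R}$, $T_t(f)(x)=f(x-t)$. Two measures are equivalent if each is absolutely continuous with respect to the other. For a Lebesgue measurable function $h$ and an interval $I\subset\mathbb{R}$, $\|h\|_{I,\infty}$ denotes the essential supremum (with respect to Lebesgue measure) of $h$ on $I$; it may a priori be $+\infty$, and the displayed inequality includes the assertion that the product is finite. *)

(* Defs.v *)
From mathcomp Require Import all_boot all_order all_algebra.
From mathcomp Require Import all_classical all_reals all_analysis.
From mathcomp Require Import measurable_realfun ess_sup_inf.
Set Implicit Arguments.
Unset Strict Implicit.
Unset Printing Implicit Defensive.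
Import Order.TTheory GRing.Theory Num.Theory.
Import numFieldNormedType.Exports.

Local Open Scope classical_set_scope.
Local Open Scope ring_scope.
Local Open Scope ereal_scope.

(* [measurableTypeR R] is [R] with its Borel sigma-algebra. *)
Definition radon_measure {R : realType}
    (mu : {measure set (measurableTypeR R) -> \bar R}) : Prop :=
  forall n : nat, mu `[(- n%:R)%R, n%:R%R]%classic < +oo.

Definition translate {R : realType} (t : R) (f : measurableTypeR R -> \bar R)
  : measurableTypeR R -> \bar R := fun x => f (x - t)%R.

Definition equivalent_measures {d} {T : measurableType d} {R : realType}
    (mu nu : {measure set T -> \bar R}) : Prop := mu `<< nu /\ nu `<< mu.

(* The library's ['d nu '/d mu] requires [nu] to be finite, hence this
   predicate: [h] is a version of the derivative of [nu] w.r.t. [mu]. *)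
Definition is_Radon_Nikodym_derivative {d} {T : measurableType d}
    {R : realType} (nu mu : {measure set T -> \bar R}) (h : T -> \bar R)
  : Prop :=
  [/\ measurable_fun [set: T] h, (forall x, 0 <= h x) &
      forall A, measurable A -> nu A = \int[mu]_(x in A) h x].

(* [h \_ I] extends [h] by 0 outside [I]; because of the absolute value this
   does not change the essential supremum when [I] is not Lebesgue-null. *)
Definition ess_sup_on {R : realType} (I : set (measurableTypeR R))
    (h : measurableTypeR R -> \bar R) : \bar R :=
  ess_sup (@lebesgue_measure R) (abse \o (h \_ I)).

(* Main.v *)
Require Import Defs.
From HB Require Import structures.
From mathcomp Require Import all_boot all_order all_algebra.
From mathcomp Require Import all_classical all_reals all_analysis.
From mathcomp Require Import measurable_realfun ess_sup_inf.
From mathcomp Require Import zify lra.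
Set Implicit Arguments.
Unset Strict Implicit.
Unset Printing Implicit Defensive.
Import Order.TTheory GRing.Theory Num.Theory.
Import numFieldNormedType.Exports.

Local Open Scope classical_set_scope.
Local Open Scope ring_scope.
Local Open Scope ereal_scope.

(** Everything goes through the property [translation_bounded]: for each [t]
    there is a finite [K] with [mu (A - t) <= K mu A] for all Borel sets [A].

    Translation invariance of the [L^p] class gives this bound
    ([translation_bounded_of_invariance]) by a gliding hump: if no [K] works for
    [t], choose [A_n] with [mu (A_n - t) > 2^(n+1) mu A_n]. Invariance of
    a.e. equality makes [mu A_n] nonzero, so one may form
    [F = \sum_n 1_(A_n) / (2^(n+1) mu A_n)]. It has integral at most 1, while
    each term of its translate has integral at least 1, and the function
    [F^(1/p)] contradicts invariance. Conversely the bound on sets extends to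
    integrals and yields invariance
    ([invariance_of_translation_bounded]).

    A nonzero sigma-finite measure whose null sets are translation invariant is
    equivalent to Lebesgue measure: apply Tonelli's theorem to the set of the
    [(x, t)] with [x + t] in [A] ([quasi_invariant_equivalent]). So there is
    a density [h], and the bound on [mu (A - t)] becomes
    [h (x + t) <= K_t h x] for a.e. [x] ([translation_bounded_density]).

    The heart of the matter is to choose [K_t] bounded for [t] in compact
    intervals ([uniform_translation_bound]). The sets
    [E_n = {t | h (x + t) <= n h x for a.e. x}] are measurable by Tonelli,
    increase to the whole line, and satisfy [E_n + E_n <= E_(n^2)]; as soon as
    [E_n] fills most of [[-2L, 2L]], the sum [E_n + E_n] contains [[-L, L]]
    ([covering_sumset]). One more use of Tonelli turns a bound for every [t]
    and a.e. [x] into [h y <= C h x] for a.e. [x] and a.e. [y] with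
    [|y - x| <= L] ([ae_pair_bound]), and taking essential suprema over an
    interval of length [L] first in [y], then in [x], gives the product bound
    ([ess_sup_product_bound]).

    For the converse, an interval of length [|t| + 1] contains a given unit
    interval together with its translate by [t], so that the product bound
    gives [h (x - t) <= C h x] on that unit interval with [C] depending on [t]
    only; countably many unit intervals cover the line
    ([translation_bounded_of_ess_sup]). *)

(** * Translations and Lebesgue measure *)

Definition shift_by {R : realType} (t : R) :
  measurableTypeR R -> measurableTypeR R := fun x => (x + t)%R.

Lemma measurable_shift_by {R : realType} (t : R) :
  measurable_fun [set: measurableTypeR R] (shift_by t).
Proof. exact: measurable_funD. Qed.

HB.instance Definition _ (R : realType) (t : R) :=
  isMeasurableFun.Build _ _ _ _ (shift_by t) (measurable_shift_by t).

Lemma measurable_preimage_shift_by {R : realType} (t : R)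
    (A : set (measurableTypeR R)) :
  measurable A -> measurable (shift_by t @^-1` A).
Proof.
by move=> mA; rewrite -[X in measurable X]setTI; exact: measurable_shift_by.
Qed.

Lemma preimage_shift_byK {R : realType} (t : R) (A : set (measurableTypeR R)) :
  shift_by (- t) @^-1` (shift_by t @^-1` A) = A.
Proof.
by apply/seteqP; split=> x; rewrite /preimage/= /shift_by subrK.
Qed.

Lemma lebesgue_measure_shift {R : realType} (t : R)
    (A : set (measurableTypeR R)) : measurable A ->
  lebesgue_measure (shift_by t @^-1` A) = lebesgue_measure A.
Proof.
move=> mA; rewrite -[LHS]/(pushforward lebesgue_measure (shift_by t) A).
apply/esym/lebesgue_measure_unique => //= _ [[a b]] _ <-.
rewrite /pushforward.
have -> : shift_by t @^-1` `]a, b] = `](a - t)%R, (b - t)%R]%classic.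
  by apply/seteqP; split=> x /=; rewrite !in_itv/= /shift_by ltrBlDr lerBrDr.
rewrite !lebesgue_measure_itv/= !lte_fin ltrD2r.
by case: ifP => // _; rewrite -!EFinB; congr (_%:E); lra.
Qed.

Lemma ge0_integral_shift {R : realType} (t : R) (A : set (measurableTypeR R))
    (f : measurableTypeR R -> \bar R) :
  measurable A -> measurable_fun setT f -> (forall x, 0 <= f x) ->
  \int[lebesgue_measure]_(x in shift_by t @^-1` A) f (x + t)%R =
  \int[lebesgue_measure]_(x in A) f x.
Proof.
move=> mA mf f0.
rewrite -(ge0_integral_pushforward (measurable_shift_by t) lebesgue_measure mA);
  [|exact: measurable_funTS|by []].
by apply: eq_measure_integral => B mB _; exact: lebesgue_measure_shift.
Qed.

Lemma ae_shift {R : realType} (t : R) (P : R -> Prop) :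
  {ae @lebesgue_measure R, forall x : measurableTypeR R, P x} ->
  {ae @lebesgue_measure R, forall x : measurableTypeR R, P (x + t)%R}.
Proof.
move=> [N [mN N0 subN]]; exists (shift_by t @^-1` N); split.
- exact: measurable_preimage_shift_by.
- by rewrite lebesgue_measure_shift.
- by move=> x /= nPx; apply: subN.
Qed.

(** * Integrals, sections and densities *)

Lemma ge0_integral_eq0P {d} {T : measurableType d} {R : realType}
    (mu : {measure set T -> \bar R}) (f : T -> \bar R) :
  measurable_fun setT f -> (forall x, 0 <= f x) ->
  \int[mu]_x f x = 0 <-> \forall x \ae mu, f x = 0.
Proof.
move=> mf f0; have := ae_eq_integral_abs mu measurableT mf.
under eq_integral do rewrite gee0_abs//.
by move=> ->; split; apply: filterS => x // /(_ I).
Qed.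

(** On [A] the function [f] is finite, so [g - f] is a positive function whose
    integral over [A] vanishes. This is how an inequality between integrals over
    all sets becomes an inequality almost everywhere. *)
Lemma null_of_integral_lt {d} {T : measurableType d} {R : realType}
    (mu : {measure set T -> \bar R}) (A : set T) (f g : T -> \bar R) :
  measurable A -> measurable_fun setT f -> measurable_fun setT g ->
  (forall x, 0 <= f x) -> (forall x, A x -> f x < g x) ->
  \int[mu]_(x in A) f x < +oo ->
  \int[mu]_(x in A) g x <= \int[mu]_(x in A) f x -> mu A = 0.
Proof.
move=> mA mf mg f0 fg intf int_le.
have f_fin x : A x -> f x \is a fin_num.
  by move=> Ax; rewrite ge0_fin_numE// (lt_le_trans (fg x Ax))// leey.
pose k x := g x - f x.
have mk : measurable_fun A k.
  by apply: emeasurable_funB; exact: measurable_funTS.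
have k_gt0 x : A x -> 0 < k x by move=> Ax; rewrite /k sube_gt0// fg.
have k_ge0 x : A x -> 0 <= k x by move=> /k_gt0/ltW.
have gE : \int[mu]_(x in A) g x = \int[mu]_(x in A) f x + \int[mu]_(x in A) k x.
  rewrite -ge0_integralD//; last exact: measurable_funTS.
  apply: eq_integral => x; rewrite inE => Ax.
  by rewrite /k addeC subeK// f_fin.
have intk0 : \int[mu]_(x in A) `|k x| = 0.
  rewrite (eq_integral k); last first.
    by move=> x; rewrite inE => Ax; rewrite gee0_abs// k_ge0.
  apply/eqP; rewrite eq_le integral_ge0// andbT.
  move: int_le; rewrite gE -[leRHS]adde0 leeD2lE//.
  by rewrite ge0_fin_numE// integral_ge0.
have [N [mN N0 subN]] := (ae_eq_integral_abs mu mA mk).1 intk0.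
apply: (subset_measure0 mA mN) => // x Ax; apply: subN => /= /(_ Ax) kx0.
by have := k_gt0 _ Ax; rewrite kx0 ltxx.
Qed.

(** Both sides say that [D] is null for the product measure, by Tonelli's
    theorem. *)
Lemma ae_null_sections {d1 d2} {T1 : measurableType d1} {T2 : measurableType d2}
    {R : realType} (m1 : {sigma_finite_measure set T1 -> \bar R})
    (m2 : {sigma_finite_measure set T2 -> \bar R}) (D : set (T1 * T2)) :
  measurable D ->
  (\forall x \ae m1, m2 (xsection D x) = 0) <->
  (\forall y \ae m2, m1 (ysection D y) = 0).
Proof.
move=> mD.
rewrite -(ge0_integral_eq0P m1 (measurable_fun_xsection m2 mD))//.
rewrite -(ge0_integral_eq0P m2 (measurable_fun_ysection m1 mD))//.
have := indic_fubini_tonelli m1 m2 mD.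
rewrite indic_fubini_tonelli_FE// indic_fubini_tonelli_GE//.
by rewrite /comp => ->.
Qed.

(** The restrictions of [nu] to the pieces of a countable partition into sets of
    finite measure are finite measures, and the sum of their densities is
    a density of [nu]. *)
Lemma sigma_finite_density {d} {T : measurableType d} {R : realType}
    (mu nu : {sigma_finite_measure set T -> \bar R}) : nu `<< mu ->
  exists h : T -> \bar R, is_Radon_Nikodym_derivative nu mu h.
Proof.
move=> numu; have [F TF /all_and2[mF nuFoo]] := sigma_finiteT nu.
pose E := seqDU F.
have mE k : measurable (E k).
  by apply: measurableD => //; exact: bigsetU_measurable.
have nuEoo k : nu (E k) < +oo.
  by rewrite (le_lt_trans _ (nuFoo k))// le_measure ?inE//; exact: subDsetl.
have UET : \bigcup_i E i = [set: T] by rewrite TF [RHS]seqDU_bigcup_eq.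
have tE := trivIset_seqDU F.
pose nu_ j : {finite_measure set T -> \bar R} := mfrestr (mE j) (nuEoo j).
have nu_mu k : nu_ k `<< mu.
  apply/null_content_dominatesP => S mS muS0.
  apply/eqP; rewrite -measure_le0.
  move/null_content_dominatesP : numu => /(_ S mS muS0) <-.
  by apply: (le_measure nu); rewrite ?inE//; exact: measurableI.
have [g g_spec] := choice (fun j => radon_nikodym_sigma_finite (nu_mu j)).
have g0 j x : 0 <= g j x by have [] := g_spec j.
have mg j : measurable_fun setT (g j).
  by have [_ _ /measurable_int] := g_spec j.
exists (fun x => \sum_(j <oo) g j x); split.
- exact: ge0_emeasurable_sum.
- by move=> x; exact: nneseries_ge0.
- move=> A mA; rewrite integral_nneseries//; last first.
    by move=> n; exact: measurable_funTS.
  rewrite -[in LHS](setIT A) -UET setI_bigcupr measure_bigcup//; last 2 first.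
    by move=> i _; exact: measurableI.
    exact: trivIset_setIl.
  rewrite (@eq_eseriesl _ _ xpredT); last by move=> j; rewrite in_setT.
  by apply: eq_eseriesr => j _; have [_ _ _ <-] := g_spec j.
Qed.

(** * Radon measures *)

Lemma radon_sigma_finite {R : realType}
    (mu : {measure set (measurableTypeR R) -> \bar R}) :
  radon_measure mu -> sigma_finite setT mu.
Proof.
move=> Hmu; exists (fun n : nat => `[(- n%:R)%R, n%:R%R]%classic).
  apply/esym/seteqP; split=> // x _.
  exists (Num.truncn `|x|).+1 => //=.
  by rewrite in_itv/= -ler_norml ltW// truncnS_gt.
by move=> n; split.
Qed.

(** A name for [mu] that carries the proof of sigma-finiteness, so that the
    sigma-finite structure can be inferred. *)
Definition radon_sigma_finite_measure {R : realType}
    (mu : {measure set (measurableTypeR R) -> \bar R})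
    (mu_radon : radon_measure mu) : set (measurableTypeR R) -> \bar R := mu.

HB.instance Definition _ (R : realType)
    (mu : {measure set (measurableTypeR R) -> \bar R})
    (mu_radon : radon_measure mu) :=
  Measure.on (radon_sigma_finite_measure mu_radon).

HB.instance Definition _ (R : realType)
    (mu : {measure set (measurableTypeR R) -> \bar R})
    (mu_radon : radon_measure mu) :=
  Measure_isSigmaFinite.Build _ _ _ (radon_sigma_finite_measure mu_radon)
    (radon_sigma_finite mu_radon).

(** * Invariance of p-integrability and boundedness of translations *)

(** Gliding hump: a failure of every constant [2^(n+1)], witnessed by sets
    [A n], yields one integrable function [F] whose composition with [phi] has
    infinite integral. It takes the place of a closed graph argument for the
    operator [F |-> F \o phi] on [L^1]. *)
Lemma preimage_bounded_of_integrability {d} {T : measurableType d}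
    {R : realType} (mu : {measure set T -> \bar R}) (phi : {mfun T >-> T}) :
  (forall A, measurable A -> mu A = 0 -> mu (phi @^-1` A) = 0) ->
  (forall F : T -> \bar R, measurable_fun setT F -> (forall x, 0 <= F x) ->
    \int[mu]_x F x < +oo -> \int[mu]_x F (phi x) < +oo) ->
  exists K : {nonneg R}, forall A, measurable A ->
    mu (phi @^-1` A) <= K%:num%:E * mu A.
Proof.
move=> null_phi int_phi; apply: contrapT => /forallNP unbounded.
have mpre A : measurable A -> measurable (phi @^-1` A).
  by move=> mA; rewrite -[X in measurable X]setTI; exact: measurable_funPT.
have /choice[A A_spec] : forall n : nat, exists B, measurable B /\
    (2 ^ n.+1)%:R%:E * mu B < mu (phi @^-1` B).
  move=> n; have /existsNP[B /not_implyP[mB /negP]] :=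
    unbounded (NngNum (ler0n R (2 ^ n.+1))).
  by rewrite -ltNge => ltB; exists B.
have mA n : measurable (A n) := (A_spec n).1.
have ltA n := (A_spec n).2.
have pow_gt0 n : (0 < (2 ^ n.+1)%:R :> R)%R by rewrite ltr0n expn_gt0.
have muA_neq0 n : mu (A n) != 0.
  apply/eqP => muA0; have := ltA n.
  by rewrite muA0 mule0 null_phi ?ltxx.
have muA_lty n : mu (A n) < +oo.
  rewrite ltey; apply/eqP => muAy; have := ltA n.
  by rewrite muAy gt0_muley ?lte_fin// ltNge leey.
pose a n := fine (mu (A n)).
have muAE n : mu (A n) = (a n)%:E by rewrite /a fineK// ge0_fin_numE.
have a_gt0 n : (0 < a n)%R.
  by rewrite -lte_fin -muAE lt0e muA_neq0 measure_ge0.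
pose c n : R := ((2 ^ n.+1)%:R * a n)^-1%R.
have c_ge0 n : (0 <= c n)%R by rewrite invr_ge0 mulr_ge0// ltW.
pose F x := \sum_(n <oo) ((c n)%:E * (\1_(A n) x)%:E).
have term_ge0 n x : 0 <= (c n)%:E * (\1_(A n) x)%:E.
  by rewrite -EFinM lee_fin mulr_ge0.
have mind n : measurable_fun setT (fun x => (\1_(A n) x)%:E : \bar R).
  by apply/measurable_EFinP; exact: measurable_indic.
have mterm n : measurable_fun setT (fun x => (c n)%:E * (\1_(A n) x)%:E).
  exact: measurable_funeM.
have mF : measurable_fun setT F by exact: ge0_emeasurable_sum.
have F_ge0 x : 0 <= F x by exact: nneseries_ge0.
have intF : \int[mu]_x F x < +oo.
  rewrite /F integral_nneseries//.
  rewrite (@eq_eseriesr _ _ (fun n => (1 / (2 ^ n.+1)%:R)%:E)); last first.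
    move=> n _; rewrite ge0_integralZl//; last by rewrite lee_fin.
    rewrite integral_indic// setIT muAE -EFinM /c invfM -mulrA mulVf ?gt_eqF//.
    by rewrite mulr1 div1r.
  by rewrite (le_lt_trans (epsilon_trick0 _ _))// ltry.
have := int_phi F mF F_ge0 intF.
rewrite /F integral_nneseries//; last first.
  by move=> n; exact: (measurableT_comp (mterm n)).
rewrite ltNge => /negP; apply.
(* Each term integrates to at least 1, so the partial sums exceed any r. *)
rewrite leye_eq; apply/eqP/eqyP => r r_gt0.
apply: (@le_trans _ _ (\sum_(0 <= n < (Num.truncn r).+1) (1 : \bar R))).
  rewrite sumEFin lee_fin sumr_const_nat subn0.
  exact/ltW/truncnS_gt.
apply: le_trans (nneseries_lim_ge (Num.truncn r).+1 _); last first.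
  by move=> n _ _; exact: integral_ge0.
apply: lee_sum => n _.
rewrite ge0_integralZl//; last by rewrite lee_fin.
  2: exact: (measurableT_comp (mind n)).
rewrite (_ : (fun x => (\1_(A n) (phi x))%:E) =
             (fun x => (\1_(phi @^-1` A n) x)%:E)); last by [].
rewrite integral_indic ?setIT//; last exact: mpre.
apply: le_trans (lee_wpmul2l _ (ltW (ltA n))); rewrite ?lee_fin//.
by rewrite muAE -!EFinM lee_fin /c mulVf// mulf_neq0// gt_eqF.
Qed.

(** The preimage under [shift_by t] is the translate [A - t]. *)
Definition translation_bounded {R : realType}
    (mu : {measure set (measurableTypeR R) -> \bar R}) : Prop :=
  forall t : R, exists K : {nonneg R}, forall A, measurable A ->
    mu (shift_by t @^-1` A) <= K%:num%:E * mu A.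

Lemma translation_bounded_null {R : realType}
    (mu : {measure set (measurableTypeR R) -> \bar R}) :
  translation_bounded mu ->
  forall (t : R) A, measurable A -> mu A = 0 -> mu (shift_by t @^-1` A) = 0.
Proof.
move=> bmu t A mA muA0; have [K /(_ A mA)] := bmu t.
by rewrite muA0 mule0 measure_le0 => /eqP.
Qed.

(** Indicator functions turn invariance of a.e. equality into invariance of null
    sets, and [F^(1/p)] turns invariance of p-integrability into that
    of integrability for nonnegative functions, which reduces to the gliding
    hump. *)
Lemma translation_bounded_of_invariance {R : realType} (p : R)
    (mu : {measure set (measurableTypeR R) -> \bar R}) : (0 < p)%R ->
  (forall f g : measurableTypeR R -> \bar R,
      measurable_fun setT f -> measurable_fun setT g ->
      f = g %[ae mu] ->
      forall t : R, translate t f = translate t g %[ae mu]) ->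
  (forall f : measurableTypeR R -> \bar R,
      measurable_fun setT f ->
      \int[mu]_x (`|f x| `^ p) < +oo ->
      forall t : R, \int[mu]_x (`|translate t f x| `^ p) < +oo) ->
  translation_bounded mu.
Proof.
move=> p0 Hae Hint t; apply: preimage_bounded_of_integrability.
- move=> A mA muA0.
  have m1 : measurable_fun setT (fun x => (\1_A x)%:E : \bar R).
    by apply/measurable_EFinP; exact: measurable_indic.
  have ae1 : (fun x => (\1_A x)%:E : \bar R) = cst 0 %[ae mu].
    exists A; split => // x /= /not_implyP[_ Ax]; apply: contrapT => nAx.
    by apply: Ax; rewrite indicE memNset.
  have [N [mN N0 subN]] := Hae _ _ m1 (measurable_cst _) ae1 (- t)%R.
  apply: (subset_measure0 (measurable_preimage_shift_by t mA) mN) => //.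
  move=> x /= Ax; apply: subN => /(_ I) /eqP; rewrite /translate/= opprK indicE.
  rewrite mem_set//=.
  by rewrite eqe oner_eq0.
- move=> F mF F0 intF.
  have FE x : `|F x `^ p^-1| `^ p = F x.
    by rewrite gee0_abs ?poweR_ge0// -poweRrM mulVf ?gt_eqF// poweRe1.
  have mf : measurable_fun setT (fun x => F x `^ p^-1).
    exact: (measurableT_comp (measurable_poweR _)).
  have -> : \int[mu]_x F (shift_by t x) =
      \int[mu]_x (`|translate (- t) (fun x => F x `^ p^-1) x| `^ p).
    by apply: eq_integral => x _; rewrite /translate opprK FE.
  by apply: Hint => //; rewrite (eq_integral F).
Qed.

(** The integral of a translate is an integral for the image measure, which is
    at most [K mu]. *)
Lemma invariance_of_translation_bounded {R : realType} (p : R)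
    (mu : {measure set (measurableTypeR R) -> \bar R}) :
  translation_bounded mu ->
  (forall f g : measurableTypeR R -> \bar R,
      measurable_fun setT f -> measurable_fun setT g ->
      f = g %[ae mu] ->
      forall t : R, translate t f = translate t g %[ae mu]) /\
  (forall f : measurableTypeR R -> \bar R,
      measurable_fun setT f ->
      \int[mu]_x (`|f x| `^ p) < +oo ->
      forall t : R, \int[mu]_x (`|translate t f x| `^ p) < +oo).
Proof.
move=> bmu; split=> [f g _ _ [N [mN N0 fgN]] t|f mf intf t].
  exists (shift_by (- t) @^-1` N); split.
  - exact: measurable_preimage_shift_by.
  - exact: translation_bounded_null.
  - by move=> x /= fgx; apply: fgN => /= /(_ I) fgE; apply: fgx => _.
have [K HK] := bmu (- t)%R.
pose F x := `|f x| `^ p.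
have mF : measurable_fun setT F.
  by apply: (measurableT_comp (measurable_poweR _)); exact: measurableT_comp.
have F0 x : 0 <= F x by exact: poweR_ge0.
rewrite (_ : \int[mu]_x _ =
    \int[pushforward mu (shift_by (- t))]_x F x); last first.
  by rewrite (ge0_integral_pushforward (measurable_shift_by (- t)) mu
    measurableT).
apply: (@le_lt_trans _ _ (\int[mscale K mu]_x F x)).
  by apply: ge0_le_measure_integral.
by rewrite ge0_integral_mscale// lte_mul_pinfty// lee_fin.
Qed.

(** * Quasi-invariance and equivalence with Lebesgue measure *)

(** In the set of the [(x, t)] with [x + t] in [A], fixing [x] leaves
    a translate of [A], of the same Lebesgue measure as [A], and fixing [t]
    leaves a translate of [A] of [mu]-measure zero exactly when [mu A = 0].
    Hence by Tonelli [A] is null for both measures or for none; since neither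
    measure is zero, an a.e. statement holds for at least one point. *)
Lemma quasi_invariant_equivalent {R : realType}
    (mu : {sigma_finite_measure set (measurableTypeR R) -> \bar R}) :
  mu setT != 0 ->
  (forall (t : R) A, measurable A -> mu A = 0 -> mu (shift_by t @^-1` A) = 0) ->
  equivalent_measures mu (@lebesgue_measure R).
Proof.
move=> mu_neq0 mu_qi.
pose leb : {sigma_finite_measure set (measurableTypeR R) -> \bar R} :=
  @lebesgue_measure R.
pose D (A : set (measurableTypeR R)) :
    set (measurableTypeR R * measurableTypeR R) :=
  (fun z => (z.1 + z.2)%R) @^-1` A.
have mD A : measurable A -> measurable (D A).
  move=> mA; rewrite -[X in measurable X]setTI.
  apply: (_ : measurable_fun setT _) => //.
  exact: measurable_funD.
have xD A x : xsection (D A) x = shift_by x @^-1` A.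
  by apply/seteqP; split=> t; rewrite /xsection /= inE /D /shift_by /= addrC.
have yD A t : ysection (D A) t = shift_by t @^-1` A.
  by apply/seteqP; split=> x; rewrite /ysection /= inE.
have mu_gt0 : 0 < mu setT by rewrite lt0e mu_neq0 measure_ge0.
have leb_gt0 : 0 < leb setT.
  apply: (@lt_le_trans _ _ (leb `[0%R, 1%R]%classic)).
    by rewrite /leb/= lebesgue_measure_itv/= lte_fin ltr01 sube0 lte_fin.
  by apply: le_measure; rewrite ?inE.
split; apply/null_content_dominatesP => A mA A0.
- have /(ae_null_sections mu leb (mD A mA)) :
      \forall x \ae mu, leb (xsection (D A) x) = 0.
    by apply: aeW => x; rewrite xD; rewrite /leb/= lebesgue_measure_shift.
  have ? := ae_properfilter_algebraOfSetsType leb_gt0.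
  move=> /filter_ex[t]; rewrite yD => At0.
  have := mu_qi (- t)%R _ (measurable_preimage_shift_by t mA) At0.
  by rewrite preimage_shift_byK.
- have /(ae_null_sections mu leb (mD A mA)) :
      \forall y \ae leb, mu (ysection (D A) y) = 0.
    by apply: aeW => t; rewrite yD; exact: mu_qi.
  have ? := ae_properfilter_algebraOfSetsType mu_gt0.
  by move=> /filter_ex[x]; rewrite xD /leb/= lebesgue_measure_shift.
Qed.

(** * Translates of the density *)

(** Integrating [h] over a translate of the set where [h (x + t) > K h x] shows
    that this set is null; cutting it by [[-n, n]] makes the integrals
    finite. *)
Lemma translation_bounded_density {R : realType}
    (mu : {measure set (measurableTypeR R) -> \bar R})
    (h : measurableTypeR R -> \bar R) :
  radon_measure mu -> is_Radon_Nikodym_derivative mu (@lebesgue_measure R) h ->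
  translation_bounded mu ->
  forall t : R, exists K : {nonneg R},
    {ae @lebesgue_measure R, forall x : measurableTypeR R,
      h (x + t)%R <= K%:num%:E * h x}.
Proof.
move=> mu_radon [mh h0 muE] bmu t; have [K HK] := bmu (- t)%R; exists K.
have mht : measurable_fun [set: measurableTypeR R] (fun x => h (x + t)%R).
  exact: (measurableT_comp mh (measurable_shift_by t)).
have mKh : measurable_fun [set: measurableTypeR R] (fun x => K%:num%:E * h x).
  exact: measurable_funeM.
pose A : set (measurableTypeR R) := [set x | K%:num%:E * h x < h (x + t)%R].
have mA : measurable A.
  by rewrite -[A]setTI; exact: measurable_lte.
pose J (n : nat) : set (measurableTypeR R) := `[(- n%:R)%R, n%:R%R]%classic.
have mJ n : measurable (J n) by exact: measurable_itv.
have mAJ n : measurable (A `&` J n) by exact: measurableI.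
have AJ0 n : lebesgue_measure (A `&` J n) = 0.
  have KmuE : K%:num%:E * mu (A `&` J n) =
      \int[lebesgue_measure]_(x in A `&` J n) (K%:num%:E * h x).
    rewrite muE// ge0_integralZl ?lee_fin//.
    exact: measurable_funTS.
  apply: (null_of_integral_lt (mAJ n) mKh mht).
  - by move=> x; rewrite mule_ge0// lee_fin.
  - by move=> x [].
  - rewrite -KmuE lte_mul_pinfty ?lee_fin//.
    by rewrite (le_lt_trans _ (mu_radon n))// le_measure// inE.
  - rewrite -KmuE (le_trans _ (HK _ (mAJ n)))// muE; last first.
      exact: measurable_preimage_shift_by.
    rewrite -(ge0_integral_shift (- t) (mAJ n) mht)//.
    by rewrite [leLHS](eq_integral h)// => x _; rewrite subrK.
exists (\bigcup_n (A `&` J n)); split.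
- exact: bigcupT_measurable.
- apply: measure_negligible; first exact: bigcupT_measurable.
  apply: negligible_bigcup => n; exists (A `&` J n); split => //; exact: AJ0.
- move=> x nle; have Ax : A x by rewrite /A/= ltNge; exact/negP.
  exists (Num.truncn `|x|).+1 => //=; split => //.
  by rewrite /J/= in_itv/= -ler_norml ltW// truncnS_gt.
Qed.

(** A quantitative substitute for the theorem of Steinhaus: once [E n] misses
    less than [L] of [[-2L, 2L]], the sets [E n] and [t - E n] together miss
    less than the length [2L] of [[-L, L]], so they meet there. *)
Lemma covering_sumset {R : realType} (E : nat -> set (measurableTypeR R))
    (L : R) :
  (forall n, measurable (E n)) -> (forall m n, (m <= n)%N -> E m `<=` E n) ->
  \bigcup_n E n = setT -> (0 < L)%R ->
  exists n, forall t, (`|t| <= L)%R -> exists s, E n s /\ E n (t - s)%R.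
Proof.
move=> mE ndE ET L0.
pose J : set (measurableTypeR R) := `[(- (2 * L))%R, (2 * L)%R]%classic.
pose B n := J `\` E n.
have mJ : measurable J by exact: measurable_itv.
have mB n : measurable (B n) by exact: measurableD.
have capB : \bigcap_n B n = set0.
  rewrite -subset0 => x Bx; have : [set: measurableTypeR R] x by [].
  by rewrite -ET => -[n _ Enx]; have [] := Bx n I.
have B0_lty : lebesgue_measure (B 0%N) < +oo.
  apply: (@le_lt_trans _ _ (lebesgue_measure J)).
    by apply: le_measure; rewrite ?inE//; exact: subDsetl.
  by rewrite /J lebesgue_measure_itv/= lte_fin; case: ifP => // _; rewrite ltry.
have cvgB : (lebesgue_measure \o B) @ \oo --> (0 : \bar R).
  rewrite -(@measure0 _ _ _ (@lebesgue_measure R)) -capB.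
  apply: nonincreasing_cvg_mu => //; first by rewrite capB.
  by move=> m n mn; apply/subsetPset; apply: setDS; exact: ndE.
have [n Bn_lt] : exists n, lebesgue_measure (B n) < L%:E.
  have : \forall n \near \oo, (lebesgue_measure \o B) n < L%:E.
    by apply: (cvgB [set y | y < L%:E]); apply: open_ereal_lt'; rewrite lte_fin.
  by move=> /filter_ex.
exists n => t tL; apply: contrapT => /forallNP noS.
(* B' is t - B n. *)
pose B' := shift_by (- t) @^-1` ((-%R : _ -> measurableTypeR R) @^-1` B n).
have mNB : measurable ((-%R : _ -> measurableTypeR R) @^-1` B n).
  rewrite -[X in measurable X]setTI.
  exact: (@oppr_measurable R setT _ _ (mB n)).
have mB' : measurable B' by exact: measurable_preimage_shift_by.
have muB' : lebesgue_measure B' = lebesgue_measure (B n).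
  by rewrite lebesgue_measure_shift//; exact: (lebesgue_measureN (mB n)).
have cover : `[(- L)%R, L]%classic `<=` B n `|` B'.
  move=> s /=; rewrite in_itv/= => /andP[sL Ls].
  move: tL; rewrite ler_norml => /andP[tL Lt].
  have [Es|nEs] := pselect (E n s).
    right; split; rewrite /J /shift_by/=.
      by rewrite in_itv/=; apply/andP; split; lra.
    by rewrite opprB => Ets; exact: (noS s).
  by left; split => //; rewrite /J/= in_itv/=; apply/andP; split; lra.
have : lebesgue_measure `[(- L)%R, L]%classic <=
    lebesgue_measure (B n) + lebesgue_measure B'.
  apply: le_trans (measureU2 _ (mB n) mB').
  by apply: le_measure => //; rewrite inE//; exact: measurableU.
rewrite muB' lebesgue_measure_itv/= lte_fin ifT; last by lra.
apply/negP; rewrite -ltNge -EFinB opprK EFinD.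
by apply: lteD.
Qed.

(** The pairs [(x, t)] that violate the bound [h (x + t) <= c h x]: its sections
    at a fixed [t] test the bound for that translation, and Tonelli's theorem
    applies to it. *)
Definition excess_set {R : realType} (c : R) (h : measurableTypeR R -> \bar R) :
    set (measurableTypeR R * measurableTypeR R) :=
  [set z | c%:E * h z.1 < h (z.1 + z.2)%R].

Lemma measurable_excess_set {R : realType} (c : R)
    (h : measurableTypeR R -> \bar R) :
  measurable_fun setT h -> measurable (excess_set c h).
Proof.
move=> mh; rewrite -[X in measurable X]setTI; apply: measurable_lte => //.
- apply: measurable_funeM; exact: (measurableT_comp mh).
- apply: (measurableT_comp mh); exact: measurable_funD.
Qed.

Lemma ysection_excess_setP {R : realType} (c t : R)
    (h : measurableTypeR R -> \bar R) : measurable_fun setT h ->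
  lebesgue_measure (ysection (excess_set c h) t) = 0 <->
  {ae @lebesgue_measure R, forall x : measurableTypeR R,
    h (x + t)%R <= c%:E * h x}.
Proof.
move=> mh.
have mD := measurable_ysection t (measurable_excess_set c mh).
split=> [D0|[N [mN N0 subN]]].
  exists (ysection (excess_set c h) t); split => // x nle.
  by rewrite /ysection/= inE /excess_set/= ltNge; exact/negP.
apply: (subset_measure0 mD mN) => // x; rewrite /ysection/= inE => lt_ch.
by apply: subN => /=; rewrite leNgt; exact/negP/negPn.
Qed.

(** With [n] given by [covering_sumset], each [t] in [[-L, L]] is a sum of two
    translations that cost a factor of at most [n] each. *)
Lemma uniform_translation_bound {R : realType}
    (h : measurableTypeR R -> \bar R) :
  measurable_fun setT h -> (forall x, 0 <= h x) ->
  (forall t : R, exists K : {nonneg R},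
    {ae @lebesgue_measure R, forall x : measurableTypeR R,
      h (x + t)%R <= K%:num%:E * h x}) ->
  forall L : R, (0 < L)%R -> exists2 C : R, (0 < C)%R &
    forall t : R, (`|t| <= L)%R ->
      {ae @lebesgue_measure R, forall x : measurableTypeR R,
        h (x + t)%R <= C%:E * h x}.
Proof.
move=> mh h0 Hh L L0.
pose E (n : nat) : set (measurableTypeR R) :=
  [set t | lebesgue_measure (ysection (excess_set n%:R h) t) = 0].
have EP n t : E n t <->
    {ae @lebesgue_measure R, forall x : measurableTypeR R,
      h (x + t)%R <= n%:R%:E * h x}.
  exact: ysection_excess_setP.
have mE n : measurable (E n).
  have := @measurable_fun_ysection _ _ _ _ _ (@lebesgue_measure R) _
    (measurable_excess_set n%:R mh).
  move=> /(_ measurableT _ (emeasurable_set1 0)).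
  by rewrite setTI.
have ndE m n : (m <= n)%N -> E m `<=` E n.
  move=> mn t /EP Hm; apply/EP; apply: filterS Hm => x /le_trans; apply.
  by rewrite lee_wpmul2r// lee_fin ler_nat.
have ET : \bigcup_n E n = setT.
  apply/seteqP; split=> // t _; have [K HK] := Hh t.
  exists (Num.truncn K%:num).+1 => //; apply/EP; apply: filterS HK => x.
  by move=> /le_trans; apply; rewrite lee_wpmul2r// lee_fin ltW// truncnS_gt.
have [n Hn] := covering_sumset mE ndE ET L0.
(* n.+1 rather than n keeps the constant positive. *)
exists (n.+1%:R * n.+1%:R)%R => [|t tL]; first by rewrite mulr_gt0// ltr0Sn.
have [s [/(ndE _ _ (leqnSn n))/EP Es /(ndE _ _ (leqnSn n))/EP Ets]] := Hn t tL.
apply: filterS2 Es (ae_shift s Ets) => x Esx Etsx.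
have -> : (x + t = x + s + (t - s))%R by lra.
apply: (le_trans Etsx); rewrite EFinM -muleA.
by apply: lee_wpmul2l; rewrite ?lee_fin.
Qed.

(** The quantifiers on [t] and [x] are exchanged by Tonelli's theorem, and
    [y = x + t]. *)
Lemma ae_pair_bound {R : realType} (C L : R) (h : measurableTypeR R -> \bar R) :
  measurable_fun setT h ->
  (forall t : R, (`|t| <= L)%R ->
    {ae @lebesgue_measure R, forall x : measurableTypeR R,
      h (x + t)%R <= C%:E * h x}) ->
  {ae @lebesgue_measure R, forall x : measurableTypeR R,
    {ae @lebesgue_measure R, forall y : measurableTypeR R,
      (`|y - x| <= L)%R -> h y <= C%:E * h x}}.
Proof.
move=> mh Hh.
pose D := excess_set C h `&` (setT `*` `[(- L)%R, L]%classic).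
have mD : measurable D.
  apply: measurableI; first exact: measurable_excess_set.
  by apply: measurableX => //; exact: measurable_itv.
have yD : \forall t \ae @lebesgue_measure R,
    lebesgue_measure (ysection D t) = 0.
  apply: aeW => t.
  have [tL|tL] := pselect (`|t| <= L)%R.
    apply: (subset_measure0 _ _ _ ((ysection_excess_setP C t mh).2 (Hh t tL))).
    - exact: measurable_ysection.
    - by apply: measurable_ysection; exact: measurable_excess_set.
    - by move=> x; rewrite /ysection/= !inE => -[].
  rewrite (_ : ysection D t = set0) ?measure0//.
  rewrite -subset0 => x; rewrite /ysection/= inE => -[_ [_ /=]].
  by rewrite in_itv/= -ler_norml.
have := (ae_null_sections (@lebesgue_measure R) (@lebesgue_measure R) mD).2 yD.
apply: filterS => x xD0.
exists (shift_by (- x) @^-1` xsection D x); split.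
- by apply: measurable_preimage_shift_by; exact: measurable_xsection.
- by rewrite lebesgue_measure_shift//; exact: measurable_xsection.
- move=> y /= /not_implyP[yxL /negP]; rewrite -ltNge => ltCh.
  rewrite /xsection /shift_by/= inE; split; last first.
    by split => //=; rewrite in_itv/= -ler_norml.
  by rewrite /excess_set/= (_ : x + (y - x) = y)%R//; lra.
Qed.

(** * Essential suprema on intervals *)

Lemma inve_le_of_le_mul {R : realType} (c : R) (u v : \bar R) :
  (0 < c)%R -> 0 <= u -> 0 <= v -> u <= c%:E * v -> v^-1 <= c%:E * u^-1.
Proof.
move=> c0 u0 v0 le_u.
have cu : c^-1%:E * u <= v by rewrite lee_pdivrMl.
have cu0 : 0 <= c^-1%:E * u by rewrite mule_ge0// lee_fin invr_ge0 ltW.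
apply: (@le_trans _ _ (c^-1%:E * u)^-1); first by rewrite lee_pV2// inE.
rewrite inveM; first by rewrite inver invr_eq0 gt_eqF// invrK.
by rewrite inveM_defE/= eqe invr_eq0 gt_eqF//= lee_fin invr_ge0 ltW//= ltry
  lte_fin invr_gt0 c0 !implybT.
Qed.

(** Equality holds except for [u = 0] and [u = +oo], where the left-hand side
    is [0]. *)
Lemma mul_inve_le {R : realType} (c : R) (u : \bar R) :
  (0 < c)%R -> 0 <= u -> u * (c%:E * u^-1) <= c%:E.
Proof.
move=> c0 u0; rewrite muleCA.
rewrite -[leRHS]mule1 lee_pmul2l//.
case: u u0 => [r||]//; last by rewrite invey mule0 lee_fin.
rewrite lee_fin le_eqVlt => /predU1P[<-|r0]; first by rewrite mul0e lee_fin.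
by rewrite inver gt_eqF// -EFinM divff ?gt_eqF.
Qed.

Lemma le_mul_of_mul_inve_le {R : realType} (c : R) (u v : \bar R) :
  (0 < c)%R -> 0 <= u -> 0 <= v -> u * v^-1 <= c%:E -> u <= c%:E * v.
Proof.
move=> c0 u0; case: v => [r||]// r0; last by rewrite gt0_muley ?lte_fin// leey.
move: r0; rewrite lee_fin le_eqVlt => /predU1P[<-|r0].
  rewrite inve0 mule0; move: u0; rewrite le_eqVlt => /predU1P[<-//|u0].
  by rewrite gt0_muley// leye_eq.
by rewrite inver gt_eqF// lee_pdivrMr.
Qed.

Lemma ess_sup_on_ge0 {R : realType} (I : set (measurableTypeR R))
    (h : measurableTypeR R -> \bar R) : 0 <= ess_sup_on I h.
Proof.
apply: ess_sup_gee; last by apply: aeW => x /=; exact: abse_ge0.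
apply: (@lt_le_trans _ _ (lebesgue_measure `[0%R, 1%R : R]%classic)).
  by rewrite lebesgue_measure_itv/= lte_fin ltr01 sube0 lte_fin.
by apply: le_measure; rewrite ?inE.
Qed.

Lemma ae_ess_sup_on {R : realType} (I : set (measurableTypeR R))
    (h : measurableTypeR R -> \bar R) :
  \forall x \ae @lebesgue_measure R, I x -> h x <= ess_sup_on I h.
Proof.
have := ess_sup_ge (@lebesgue_measure R) (abse \o (h \_ I)).
apply: filterS => x /= hx_le Ix; apply: le_trans hx_le.
by rewrite patchE mem_set// lee_abs.
Qed.

Lemma ess_sup_on_le {R : realType} (I : set (measurableTypeR R))
    (h : measurableTypeR R -> \bar R) (M : \bar R) :
  (forall x, 0 <= h x) -> 0 <= M ->
  (\forall x \ae @lebesgue_measure R, I x -> h x <= M) -> ess_sup_on I h <= M.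
Proof.
move=> h0 M0 leM; apply/ess_supP; apply: filterS leM => x leM /=.
rewrite patchE; case: ifPn => [|_]; last by rewrite abse0.
by rewrite inE => /leM; rewrite gee0_abs.
Qed.

(** For a.e. [x] in [I] the pairwise bound says that [C h x] is at least the
    essential supremum [M] of [h], so [1 / h x <= C / M]. The degenerate cases
    [M = 0] and [M = +oo] are covered by the conventions of extended real
    arithmetic. *)
Lemma ess_sup_product_bound {R : realType} (C L : R)
    (h : measurableTypeR R -> \bar R) (I : set (measurableTypeR R)) :
  (0 < C)%R -> (forall x, 0 <= h x) ->
  (forall x y, I x -> I y -> (`|y - x| <= L)%R) ->
  {ae @lebesgue_measure R, forall x : measurableTypeR R,
    {ae @lebesgue_measure R, forall y : measurableTypeR R,
      (`|y - x| <= L)%R -> h y <= C%:E * h x}} ->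
  ess_sup_on I h * ess_sup_on I (fun x => (h x)^-1) <= C%:E.
Proof.
move=> C0 h0 diamI pairs; set M := ess_sup_on I h.
have M0 : 0 <= M by exact: ess_sup_on_ge0.
have leM : \forall x \ae @lebesgue_measure R, I x -> M <= C%:E * h x.
  apply: filterS pairs => x pairx Ix.
  apply: ess_sup_on_le => //; first by rewrite mule_ge0// lee_fin ltW.
  by apply: filterS pairx => y le_y Iy; apply: le_y; exact: diamI.
apply: le_trans (mul_inve_le C0 M0); rewrite lee_wpmul2l//.
apply: ess_sup_on_le => [x||]; first by rewrite inve_ge0.
  by rewrite mule_ge0// ?inve_ge0// lee_fin ltW.
by apply: filterS leM => x leMx Ix; apply: inve_le_of_le_mul => //; exact: leMx.
Qed.

(** The product [h (x + t) * (1 / h x)] is at most the product of the essential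
    suprema as soon as [x] and [x + t] both lie in the interval. *)
Lemma density_translate_on_interval {R : realType} (C a L t : R)
    (h : measurableTypeR R -> \bar R) :
  (0 < C)%R -> (forall x, 0 <= h x) ->
  let I : set (measurableTypeR R) := `[a, (a + L)%R]%classic in
  ess_sup_on I h * ess_sup_on I (fun x => (h x)^-1) <= C%:E ->
  {ae @lebesgue_measure R, forall x : measurableTypeR R,
    I x -> I (x + t)%R -> h (x + t)%R <= C%:E * h x}.
Proof.
move=> C0 h0 I HC.
have := ae_shift t (ae_ess_sup_on I h).
apply: filterS2 (ae_ess_sup_on I (fun x => (h x)^-1)) => x le_inv le_h Ix Ixt.
apply: le_mul_of_mul_inve_le => //; apply: le_trans HC.
by apply: lee_pmul; rewrite ?inve_ge0//; [exact: le_h|exact: le_inv].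
Qed.

(** The constant for the length [|t| + 1] serves all unit intervals [[k, k + 1[]
    with [k] an integer, because [[k, k + 1]] and its translate by [- t] lie in
    a common interval of that length. *)
Lemma translation_bounded_of_ess_sup {R : realType}
    (mu : {measure set (measurableTypeR R) -> \bar R})
    (h : measurableTypeR R -> \bar R) :
  is_Radon_Nikodym_derivative mu (@lebesgue_measure R) h ->
  (forall L : R, (0 < L)%R -> exists C : R, forall a : R,
    let I : set (measurableTypeR R) := `[a, (a + L)%R]%classic in
    ess_sup_on I h * ess_sup_on I (fun x => (h x)^-1) <= C%:E) ->
  translation_bounded mu.
Proof.
move=> [mh h0 muE] HL t.
have [C0 HC0] : exists C : R, forall a : R,
    let I : set (measurableTypeR R) := `[a, (a + (`|t| + 1))%R]%classic in
    ess_sup_on I h * ess_sup_on I (fun x => (h x)^-1) <= C%:E.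
  by apply: HL; rewrite ltr_wpDl.
pose C : R := Num.max C0 1%R.
have C_gt0 : (0 < C)%R by rewrite lt_max ltr01 orbT.
have HC a :
    let I : set (measurableTypeR R) := `[a, (a + (`|t| + 1))%R]%classic in
    ess_sup_on I h * ess_sup_on I (fun x => (h x)^-1) <= C%:E.
  by apply: le_trans (HC0 a) _; rewrite lee_fin le_max lexx.
(* [k + b, k + b + |t| + 1] contains [k, k + 1] and [k - t, k + 1 - t]. *)
pose b : R := (Num.min 0 (- t))%R.
have unit_bound (k : int) :
  {ae @lebesgue_measure R, forall x : measurableTypeR R,
    (k%:~R <= x < k%:~R + 1)%R -> h (x - t)%R <= C%:E * h x}.
  have := density_translate_on_interval (- t)%R C_gt0 h0 (HC (k%:~R + b)%R).
  apply: filterS => x Hx /andP[kx xk]; apply: Hx => /=; rewrite in_itv/= /b.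
    by case: (leP 0 (- t))%R => ht; [rewrite ler0_norm|rewrite gtr0_norm];
      try (apply/andP; split); lra.
  by case: (leP 0 (- t))%R => ht; [rewrite ler0_norm|rewrite gtr0_norm];
    try (apply/andP; split); lra.
have bound : {ae @lebesgue_measure R, forall x : measurableTypeR R,
    h (x - t)%R <= C%:E * h x}.
  (* Countable intersections are indexed by nat: take both signs of k. *)
  have /ae_foralln : forall n : nat,
      {ae @lebesgue_measure R, forall x : measurableTypeR R,
        forall k : int, `|k|%N = n ->
        (k%:~R <= x < k%:~R + 1)%R -> h (x - t)%R <= C%:E * h x}.
    move=> n; have := unit_bound (- n%:Z)%R.
    apply: filterS2 (unit_bound n%:Z) => x Hp Hn k kn.
    have [->|->] : k = n%:Z \/ k = (- n%:Z)%R by lia.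
      exact: Hp.
    exact: Hn.
  apply: filterS => x Hx; apply: (Hx `|Num.floor x|%N (Num.floor x)) => //.
  by rewrite floor_le -[X in (_ + X)%R]/(1%:~R) -intrD floorD1_gt.
exists (NngNum (ltW C_gt0)) => A mA /=.
have mht : measurable_fun [set: measurableTypeR R] (fun x => h (x - t)%R).
  exact: (measurableT_comp mh (measurable_shift_by (- t))).
rewrite muE; last exact: measurable_preimage_shift_by.
have -> : \int[lebesgue_measure]_(x in shift_by t @^-1` A) h x =
    \int[lebesgue_measure]_(x in A) h (x - t)%R.
  rewrite -(ge0_integral_shift t mA mht)//.
  by apply: eq_integral => x _; rewrite addrK.
have C_ge0 : 0 <= C%:E by rewrite lee_fin ltW.
rewrite muE// -ge0_integralZl//; last exact: measurable_funTS.
apply: ae_ge0_le_integral => //.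
- exact: measurable_funTS.
- by move=> x _; rewrite mule_ge0.
- by apply: measurable_funeM; exact: measurable_funTS.
- by apply: filterS bound.
Qed.

(** * The characterization *)

Theorem theorem4 (R : realType) (p : R) (hp : (1 <= p)%R)
    (mu : {measure set (measurableTypeR R) -> \bar R})
    (mu_radon : radon_measure mu)
    (mu_neq0 : mu [set: measurableTypeR R] != 0) :
  ((forall f g : measurableTypeR R -> \bar R,
      measurable_fun setT f -> measurable_fun setT g ->
      f = g %[ae mu] ->
      forall t : R, translate t f = translate t g %[ae mu]) /\
   (forall f : measurableTypeR R -> \bar R,
      measurable_fun setT f ->
      \int[mu]_x (`|f x| `^ p) < +oo ->
      forall t : R, \int[mu]_x (`|translate t f x| `^ p) < +oo))
  <->
  (equivalent_measures mu (@lebesgue_measure R) /\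
   exists2 h : measurableTypeR R -> \bar R,
     is_Radon_Nikodym_derivative mu (@lebesgue_measure R) h &
     forall L : R, (0 < L)%R ->
       exists C : R, forall (a : R) (bl br : bool),
         let I : set R := [set` Interval (BSide bl a) (BSide br (a + L)%R)] in
         ess_sup_on I h * ess_sup_on I (fun x => (h x)^-1) <= C%:E).
Proof.
split=> [[Hae Hint]|[_ [h h_density Hh]]].
- have bmu := translation_bounded_of_invariance (lt_le_trans ltr01 hp) Hae Hint.
  pose smu : {sigma_finite_measure set (measurableTypeR R) -> \bar R} :=
    radon_sigma_finite_measure mu_radon.
  have mu_equiv : equivalent_measures mu (@lebesgue_measure R).
    exact: (@quasi_invariant_equivalent R smu mu_neq0
      (translation_bounded_null bmu)).
  split=> //.
  have [h h_density] :=
    @sigma_finite_density _ _ R (@lebesgue_measure R) smu mu_equiv.1.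
  exists h => // L L0.
  have [mh h0 _] := h_density.
  have [C C0 HC] := uniform_translation_bound mh h0
    (translation_bounded_density mu_radon h_density bmu) L0.
  exists C => a bl br.
  pose I : set (measurableTypeR R) :=
    [set` Interval (BSide bl a) (BSide br (a + L)%R)].
  have in_cc z : I z -> (a <= z <= a + L)%R.
    by rewrite /I/= in_itv; case: (bl); case: (br) => /= /andP[? ?];
      apply/andP; split; lra.
  have diamI x y : I x -> I y -> (`|y - x| <= L)%R.
    move=> /in_cc/andP[ax xa] /in_cc/andP[ay ya].
    by rewrite ler_norml; apply/andP; split; lra.
  exact: ess_sup_product_bound C0 h0 diamI (ae_pair_bound mh HC).
- apply: invariance_of_translation_bounded.
  apply: (translation_bounded_of_ess_sup h_density) => L L0.
  by have [C HC] := Hh L L0; exists C => a; exact: HC.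
Qed.
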